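(* Let $\alpha>1$ be real. For integers $d\geq 2$ with $k=\alpha d$ an integer, let $c(d)$ be the competitive ratio of Algorithm OCS run with the function $f^*_d$ for online bipartite matching on $(k,d)$-bounded graphs. Then $\liminf_{d\to\infty}c(d)\geq 1-\left(\frac{1}{3e}\right)^{\alpha}$ (the limit taken over $d$ with $\alpha d$ an integer).
   Context: Online bipartite matching: offline servers, online requests arriving one at a time in adversarial order; each arriving request's neighbors are revealed and it is irrevocably matched to an unmatched neighbor or left unmatched. Competitive ratio on a class: infimum of $\mathbb{E}[\mathsf{ALG}]/\mathsf{OPT}$ (matching size vs. maximum matching size). $(k,d)$-bounded: every server has degree at least $k$, every request has degree at most $d$. The function $f^*_d:\{0,1,\ldots\}\to\mathbb{R}$: $f^*_d(0)=1$ and $f^*_d(l)=f^*_d(l-1)\cdot\min_{1\leq m<d}\left(1+\frac{m f^*_d(l-1)}{d-m}\right)^{1/m}$ for $l\geq1$. Algorithm OCS (with $f$): when request $r$ arrives, for each server $s$ let $l_s$ be the number of neighbors of $s$ that arrived before $r$; let $A$ be the set of unmatched neighbors of $r$; if $A\neq\emptyset$, match $r$ to $s\in A$ with probability $f(l_s)/\sum_{s'\in A}f(l_{s'})$. *)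

(* Defs.v *)
From HB Require Import structures.
From mathcomp Require Import all_boot all_order all_algebra.
From mathcomp Require Import all_classical all_reals all_analysis.

Set Implicit Arguments.
Unset Strict Implicit.
Unset Printing Implicit Defensive.

Import Order.TTheory GRing.Theory Num.Theory.

Local Open Scope classical_set_scope.
Local Open Scope ring_scope.

(* An instance with m servers and n requests is its adjacency relation
   [e : 'I_m -> 'I_n -> bool]; the requests arrive in the order 0, 1, ..., n-1,
   so ranging over all [e] also ranges over all arrival orders. *)

Definition bounded_graph (k d m n : nat) (e : 'I_m -> 'I_n -> bool) : Prop :=
  (forall s : 'I_m, (k <= #|[set r : 'I_n | e s r]%SET|)%N) /\
  (forall r : 'I_n, (#|[set s : 'I_m | e s r]%SET| <= d)%N).

Definition matching (m n : nat) (e : 'I_m -> 'I_n -> bool)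
    (M : {set 'I_m * 'I_n}) : bool :=
  [forall p in M, e p.1 p.2] &&
  [forall p in M, forall q in M, (p.1 == q.1) || (p.2 == q.2) ==> (p == q)].

Definition OPT (m n : nat) (e : 'I_m -> 'I_n -> bool) : nat :=
  \max_(M : {set 'I_m * 'I_n} | matching e M) #|M|.

Section OCS.
Context {R : realType} (f : nat -> R) (m n : nat) (e : 'I_m -> 'I_n -> bool).

Definition arrived_neighbors (s : 'I_m) (r : 'I_n) : nat :=
  #|[set r' : 'I_n | e s r' && (r' < r)%N]%SET|.

Definition available (M : {set 'I_m * 'I_n}) (r : 'I_n) : {set 'I_m} :=
  [set s | e s r && [forall r' : 'I_n, (s, r') \notin M]]%SET.

Definition OCS_choice (M : {set 'I_m * 'I_n}) (r : 'I_n) (s : 'I_m) : R :=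
  f (arrived_neighbors s r) /
  \sum_(s' in available M r) f (arrived_neighbors s' r).

(* Probability that the matching is M' after the arrival of r, given that it
   is M just before. *)
Definition OCS_step (r : 'I_n) (M M' : {set 'I_m * 'I_n}) : R :=
  if available M r == finset.set0 then (M' == M)%:R
  else \sum_(s in available M r)
         OCS_choice M r s * (M' == ((s, r) |: M)%SET)%:R.

(* Law of the final matching; [enum 'I_n] lists the requests increasingly. *)
Definition OCS_law : {set 'I_m * 'I_n} -> R :=
  foldl (fun (mu : {set 'I_m * 'I_n} -> R) (r : 'I_n) M' =>
           \sum_(M : {set 'I_m * 'I_n}) mu M * OCS_step r M M')
        (fun M => (M == finset.set0)%:R)
        (enum 'I_n).

Definition E_OCS : R := \sum_(M : {set 'I_m * 'I_n}) OCS_law M * #|M|%:R.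

End OCS.

(* The ratio is only taken over instances with at least one edge, as it is
   0/0 otherwise. *)
Definition OCS_competitive_ratio {R : realType} (f : nat -> R) (k d : nat) :
    \bar R :=
  ereal_inf [set x : \bar R |
    exists (m n : nat) (e : 'I_m -> 'I_n -> bool),
      [/\ bounded_graph k d e, (0 < OPT e)%N
        & x = (E_OCS f e / (OPT e)%:R)%:E]].

(* Meaningful for d >= 2 only: the minimum over 1 <= m < d is then over a
   nonempty range, and its default value is the term for m = 1. *)
Fixpoint fstar (R : realType) (d l : nat) : R :=
  if l is l'.+1 then
    let y := fstar R d l' in
    let t (m : nat) : R := (1 + m%:R * y / (d%:R - m%:R)) `^ (m%:R^-1) in
    y * \big[Num.min/t 1%N]_(1 <= m < d) t m
  else 1.

(* Main.v *)
Require Import Defs.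
From HB Require Import structures.
From mathcomp Require Import all_boot all_order all_algebra.
From mathcomp Require Import all_classical all_reals all_analysis.
From mathcomp Require Import ring lra.

(** Write [f] for [fstar R d] and let [l_s] be the number of neighbors of the
    server [s] that have arrived. By induction on the arrivals, every set [S] of
    servers satisfies
      [P(all of S is unmatched) <= \prod_(s in S) 1 / f (l_s)].
    If [T] is the set of neighbors of the arriving request in [S], then [S] stays
    unmatched with conditional probability [X / (X + Y)], where [Y] is the weight
    of [T] and [X] that of the other available servers. Replacing this concave
    function of [X] by its tangent line at [d - #|T|] leaves an expression linear
    in the probabilities for [S] and for the sets [s |: S], to which the induction
    hypothesis applies; the recursion of [f] and AM-GM absorb the resulting factor.
    Hence the competitive ratio is at least [1 - 1 / f k].

    In the time scale [l / d], [f] grows at least like the solution of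
    [y' = y h(y)], [y(0) = 1], where [h(y)] is the infimum over [v > 0] of
    [ln (1 + v) (1 + y / v)]; the substitution [v = m y / (d - m)] makes the
    comparison exact for every [d]. The function [h] is concave, [h(y) = y] on
    [0, 2], and [h] is known at a second point, about [(4.87, 3.52)]. Bounding [h]
    by [y], then by the chord, then by 3.52, the solution reaches 2 at time 1/2,
    4.88 before time 0.848 and [3 e] before time 1, and from then on its
    logarithmic derivative exceeds [ln (3 e)]. *)

Set Implicit Arguments.
Unset Strict Implicit.
Unset Printing Implicit Defensive.

Import Order.TTheory GRing.Theory Num.Theory.

Local Open Scope classical_set_scope.
Local Open Scope ring_scope.

(** * Unmatched servers *)

Section OCSAnalysis.
Context {R : realType} (f : nat -> R) (d m n : nat) (e : 'I_m -> 'I_n -> bool).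

(** [OCS_law] stopped after [j] arrivals, to allow induction on [j]. *)
Definition OCS_dist (j : nat) : {set 'I_m * 'I_n} -> R :=
  foldl (fun (mu : {set 'I_m * 'I_n} -> R) (r : 'I_n) M' =>
           \sum_(M : {set 'I_m * 'I_n}) mu M * OCS_step f e r M M')
        (fun M => (M == finset.set0)%:R)
        (take j (enum 'I_n)).

Definition unmatched (S : {set 'I_m}) (M : {set 'I_m * 'I_n}) : bool :=
  [forall s in S, forall r : 'I_n, (s, r) \notin M].

Definition prob_unmatched (j : nat) (S : {set 'I_m}) : R :=
  \sum_(M : {set 'I_m * 'I_n}) OCS_dist j M * (unmatched S M)%:R.

(** At [j = r] this unfolds to [arrived_neighbors e s r]; a natural number as index also allows
    [j = n], which gives the degree. *)
Definition past (j : nat) (s : 'I_m) : nat :=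
  #|[set r : 'I_n | e s r && (r < j)%N]%SET|.

Lemma OCS_distS (r : 'I_n) M' :
  OCS_dist r.+1 M' = \sum_(M : {set 'I_m * 'I_n}) OCS_dist r M * OCS_step f e r M M'.
Proof.
rewrite /OCS_dist (take_nth r) ?size_enum_ord// foldl_rcons.
by rewrite nth_ord_enum.
Qed.

Lemma OCS_law_dist : OCS_law f e = OCS_dist n.
Proof. by rewrite /OCS_dist take_oversize// size_enum_ord. Qed.

Lemma pastS (r : 'I_n) (s : 'I_m) : past r.+1 s = (past r s + e s r)%N.
Proof.
rewrite /past; case: (boolP (e s r)) => h.
  rewrite addn1 [LHS](cardsD1 r) inE h ltnSn add1n; congr _.+1.
  apply: eq_card => x; rewrite !inE ltnS leq_eqVlt -val_eqE.
  by case: (ltngtP x r) => //=; rewrite ?andbF.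
rewrite addn0; apply: eq_card => x; rewrite !inE ltnS leq_eqVlt.
case: (x =P r) => [->|/eqP]; first by rewrite (negbTE h).
by rewrite -val_eqE => /negbTE ->.
Qed.

Lemma past0 s : past 0 s = 0%N.
Proof. by apply: eq_card0 => r; rewrite !inE andbF. Qed.

Lemma past_n s : past n s = #|[set r : 'I_n | e s r]%SET|.
Proof. by apply: eq_card => r; rewrite !inE ltn_ord andbT. Qed.

Lemma unmatchedU1 s S M :
  unmatched (s |: S)%SET M = unmatched S M && [forall r : 'I_n, (s, r) \notin M].
Proof.
apply/idP/andP => [/forall_inP h|[/forall_inP hS hs]].
  split; last by apply: h; rewrite !inE eqxx.
  by apply/forall_inP => s' hs'; apply: h; rewrite !inE hs' orbT.
by apply/forall_inP => s'; rewrite !inE => /orP[/eqP -> //|/hS].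
Qed.

Lemma unmatched_setU1 (s : 'I_m) (r : 'I_n) S M :
  unmatched S ((s, r) |: M)%SET = (s \notin S) && unmatched S M.
Proof.
apply/forall_inP/andP => [h|[sS /forall_inP h] s' hs'].
  split; first by apply/negP => /h /forallP/(_ r); rewrite !inE eqxx.
  apply/forall_inP => s' /h /forallP h'; apply/forallP => r'.
  by have := h' r'; rewrite !inE negb_or => /andP[].
apply/forallP => r'; rewrite !inE negb_or (forallP (h _ hs') r') andbT.
by apply: contra sS => /eqP[<- _].
Qed.

Lemma sum_mulr_pred1 (T : finType) (F : T -> R) (a : T) :
  \sum_(x : T) (x == a)%:R * F x = F a.
Proof.
rewrite (bigD1 a)//= eqxx mul1r big1 ?addr0// => x /negbTE ->.
by rewrite mul0r.
Qed.

Lemma OCS_step_unmatched (r : 'I_n) M S :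
  \sum_(M' : {set 'I_m * 'I_n}) OCS_step f e r M M' * (unmatched S M')%:R =
  if available e M r == finset.set0 then (unmatched S M)%:R
  else (unmatched S M)%:R *
       \sum_(s in available e M r | s \notin S) OCS_choice f e M r s.
Proof.
rewrite /OCS_step; case: ifP => hA.
  exact: (sum_mulr_pred1 (fun M' => (unmatched S M')%:R)).
under eq_bigr do rewrite mulr_suml.
rewrite exchange_big/= big_mkcondr mulr_sumr; apply: eq_bigr => s sA.
under eq_bigr do rewrite -mulrA.
rewrite -mulr_sumr sum_mulr_pred1 unmatched_setU1.
by case: (s \in S); rewrite /= ?mulr0// mulrC.
Qed.

Hypothesis f_gt0 : forall l, 0 < f l.

Lemma sum_f_gt0 (g : 'I_m -> nat) (A : {set 'I_m}) :
  A != finset.set0 -> 0 < \sum_(s in A) f (g s).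
Proof.
case/set0Pn => s sA; rewrite (bigD1 s)//= ltr_pwDl// sumr_ge0// => i _.
exact: ltW.
Qed.

Lemma OCS_choice_ge0 M r s : 0 <= OCS_choice f e M r s.
Proof.
by apply: divr_ge0; [|apply: sumr_ge0 => s' _]; apply: ltW.
Qed.

Lemma sum_OCS_choice M r : available e M r != finset.set0 ->
  \sum_(s in available e M r) OCS_choice f e M r s = 1.
Proof.
by move=> hA; rewrite -mulr_suml divff// gt_eqF// sum_f_gt0.
Qed.

Lemma OCS_step_ge0 r M M' : 0 <= OCS_step f e r M M'.
Proof.
rewrite /OCS_step; case: ifP => _; first by rewrite ler0n.
by apply: sumr_ge0 => s _; rewrite mulr_ge0 ?OCS_choice_ge0 ?ler0n.
Qed.

Lemma OCS_dist_ge0 j M : (j <= n)%N -> 0 <= OCS_dist j M.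
Proof.
elim: j M => [|j IH] M jn; first by rewrite /OCS_dist take0/= ler0n.
rewrite (OCS_distS (Ordinal jn)) sumr_ge0// => M' _.
by rewrite mulr_ge0 ?OCS_step_ge0// IH// ltnW.
Qed.

Lemma unmatched0 M : unmatched finset.set0 M.
Proof. by apply/forall_inP => s; rewrite inE. Qed.

Lemma sum_OCS_dist j : (j <= n)%N -> \sum_M OCS_dist j M = 1.
Proof.
elim: j => [|j IH] jn.
  have := sum_mulr_pred1 (fun=> 1) (finset.set0 : {set 'I_m * 'I_n}).
  by under eq_bigr do rewrite mulr1; rewrite /OCS_dist take0.
under eq_bigr do rewrite (OCS_distS (Ordinal jn)).
rewrite exchange_big/= -[RHS](IH (ltnW jn)); apply: eq_bigr => M _.
rewrite -mulr_sumr -[RHS]mulr1; congr (_ * _).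
have := OCS_step_unmatched (Ordinal jn) M finset.set0.
under eq_bigr do rewrite unmatched0 mulr1.
move=> ->; rewrite unmatched0; case: ifPn => // hA.
by rewrite mul1r; under eq_bigl do rewrite finset.in_set0 andbT; rewrite sum_OCS_choice.
Qed.

(* Tangent line at [x0] of the concave function [x |-> x / (x + y)]. *)
Lemma frac_le_tangent (x y x0 : R) : 0 <= x -> 0 < y -> 0 <= x0 ->
  x / (x + y) <= (x0 / (x0 + y)) ^+ 2 + y / (x0 + y) ^+ 2 * x.
Proof.
move=> x_ge0 y_gt0 x0_ge0.
have xy : 0 < x + y by lra.
have x0y : 0 < x0 + y by lra.
rewrite -subr_ge0.
have -> : (x0 / (x0 + y)) ^+ 2 + y / (x0 + y) ^+ 2 * x - x / (x + y) =
  y * (x - x0) ^+ 2 / ((x0 + y) ^+ 2 * (x + y)).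
  by field; rewrite !gt_eqF.
by apply: divr_ge0; apply: mulr_ge0; rewrite ?sqr_ge0 ?(ltW y_gt0) ?(ltW xy).
Qed.

(** When [S] is unmatched, a neighbor [s] outside [S] is available exactly if [s |: S] is unmatched
    too. The random weight is thus a combination of indicators, and the tangent line keeps the bound
    linear in them. *)
Lemma OCS_step_unmatched_le (r : 'I_n) M (S : {set 'I_m}) (x0 : R) :
  let y := \sum_(s in S | e s r) f (past r s) in
  0 <= x0 -> 0 < y ->
  \sum_(M' : {set 'I_m * 'I_n}) OCS_step f e r M M' * (unmatched S M')%:R <=
  (x0 / (x0 + y)) ^+ 2 * (unmatched S M)%:R + y / (x0 + y) ^+ 2 *
    \sum_(s | (s \notin S) && e s r)
      f (past r s) * (unmatched (s |: S)%SET M)%:R.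
Proof.
move=> y x0_ge0 y_gt0; rewrite OCS_step_unmatched.
have [uS|uS] := boolP (unmatched S M); last first.
  rewrite mul0r mulr0 add0r; under [in leRHS]eq_bigr do
    rewrite unmatchedU1 (negbTE uS) mulr0.
  by rewrite big1// mulr0; case: ifP.
have AS s : s \in S -> (s \in available e M r) = e s r.
  by move=> sS; rewrite inE (forall_inP uS)// andbT.
have Y : y = \sum_(s in available e M r | s \in S) f (past r s).
  apply: eq_bigl => s; case: (boolP (s \in S)) => sS; last by rewrite andbF.
  by rewrite AS// andbT.
set x := \sum_(s | (s \notin S) && e s r) _.
have X : x = \sum_(s in available e M r | s \notin S) f (past r s).
  rewrite /x big_mkcond [RHS]big_mkcond; apply: eq_bigr => s _.
  rewrite unmatchedU1 uS/= inE.
  case: (s \in S); rewrite ?andbF//=; case: (e s r) => //=.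
  by case: [forall r' : 'I_n, _]; rewrite ?mulr1 ?mulr0.
have hA : available e M r != finset.set0.
  apply: contraTneq y_gt0 => A0; rewrite Y A0 big_pred0 ?ltxx// => s.
  by rewrite inE.
rewrite (negbTE hA) mul1r mulr1.
have -> : \sum_(s in available e M r | s \notin S) OCS_choice f e M r s =
    x / (x + y).
  rewrite -mulr_suml -X; congr (_ / _).
  by rewrite X Y (bigID (mem S))/= addrC.
apply: frac_le_tangent => //.
by rewrite X sumr_ge0// => s _; apply: ltW.
Qed.

Lemma prob_unmatchedS (r : 'I_n) S : prob_unmatched r.+1 S =
  \sum_M OCS_dist r M *
    \sum_(M' : {set 'I_m * 'I_n}) OCS_step f e r M M' * (unmatched S M')%:R.
Proof.
rewrite /prob_unmatched; under eq_bigr do rewrite OCS_distS mulr_suml.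
rewrite exchange_big/=; apply: eq_bigr => M _; rewrite mulr_sumr.
by apply: eq_bigr => M' _; rewrite mulrA.
Qed.

Lemma prob_unmatchedS_le (r : 'I_n) (S : {set 'I_m}) (x0 : R) :
  let y := \sum_(s in S | e s r) f (past r s) in
  0 <= x0 -> 0 < y ->
  prob_unmatched r.+1 S <=
  (x0 / (x0 + y)) ^+ 2 * prob_unmatched r S + y / (x0 + y) ^+ 2 *
    \sum_(s | (s \notin S) && e s r)
      f (past r s) * prob_unmatched r (s |: S)%SET.
Proof.
move=> y x0_ge0 y_gt0; rewrite prob_unmatchedS.
apply: le_trans.
  apply: ler_sum => M _; apply: ler_wpM2l.
    exact: (OCS_dist_ge0 _ (ltnW (ltn_ord r))).
  exact: (OCS_step_unmatched_le M x0_ge0 y_gt0).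
rewrite -/y.
under eq_bigr do rewrite mulrDr mulrCA (mulrCA _ (y / _)) mulr_sumr.
rewrite big_split/= -!mulr_sumr exchange_big/= lerD2l.
rewrite le_eqVlt; apply/orP; left; apply/eqP; congr (_ * _).
apply: eq_bigr => s _; rewrite mulr_sumr; apply: eq_bigr => M _.
by rewrite mulrCA.
Qed.

(** Serves for requests without a neighbor in [S]: there [y = 0], which the tangent bound
    excludes. *)
Lemma prob_unmatchedS_le_id (r : 'I_n) S :
  prob_unmatched r.+1 S <= prob_unmatched r S.
Proof.
rewrite prob_unmatchedS; apply: ler_sum => M _.
rewrite ler_wpM2l ?OCS_dist_ge0 ?(ltnW (ltn_ord r))// OCS_step_unmatched.
case: ifPn => // hA; rewrite ler_piMr ?ler0n// -(sum_OCS_choice hA).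
rewrite big_mkcondr ler_sum// => s _; case: ifP => // _.
exact: OCS_choice_ge0.
Qed.

Hypothesis f0 : f 0%N = 1.
Hypothesis f_growth : forall l j, (0 < j < d)%N ->
  (f l.+1 / f l) ^+ j <= 1 + j%:R * f l / (d%:R - j%:R).
Hypothesis degree_le : forall r, (#|[set s : 'I_m | e s r]%SET| <= d)%N.

(** After raising to the power [#|T|], [f_growth] with [j = #|T|] bounds each factor, and AM-GM
    replaces the product by a power of the mean. *)
Lemma prod_growth_le (T : {set 'I_m}) (l : 'I_m -> nat) : (0 < #|T| < d)%N ->
  \prod_(s in T) (f (l s).+1 / f (l s)) <=
  1 + (\sum_(s in T) f (l s)) / (d%:R - #|T|%:R).
Proof.
move=> Td; have /andP[T0 Tltd] := Td; set t := #|T| in Td T0 Tltd *.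
have tR : 0 < t%:R :> R by rewrite ltr0n.
have dt : 0 < d%:R - t%:R :> R by rewrite subr_gt0 ltr_nat.
have S0 : 0 <= \sum_(s in T) f (l s) by apply: sumr_ge0 => s _; apply: ltW.
have E0 s : 0 <= 1 + t%:R * f (l s) / (d%:R - t%:R).
  by rewrite addr_ge0// divr_ge0 ?mulr_ge0 ?ltW.
rewrite -(@ler_pXn2r _ t)// ?nnegrE ?prodr_ge0//; last 2 first.
- by move=> s _; rewrite divr_ge0// ltW.
- by rewrite addr_ge0// divr_ge0// ltW.
rewrite -prodrXl.
apply: (@le_trans _ _ (\prod_(s in T) (1 + t%:R * f (l s) / (d%:R - t%:R)))).
  apply: ler_prod => s _; rewrite f_growth// andbT.
  by rewrite exprn_ge0// divr_ge0// ltW.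
have := leif_AGM (fun s (_ : s \in mem T) => E0 s).
case=> + _; rewrite -/t => /le_trans; apply.
rewrite big_split/= sumr_const -/t -mulr_suml -mulr_sumr.
rewrite le_eqVlt; apply/orP; left; apply/eqP; congr (_ ^+ _).
by field; rewrite !gt_eqF.
Qed.

Lemma prob_unmatched_le j S : (j <= n)%N ->
  prob_unmatched j S <= \prod_(s in S) (f (past j s))^-1.
Proof.
elim: j S => [|j IH] S jn.
  under eq_bigr do rewrite past0 f0 invr1.
  rewrite big1_eq /prob_unmatched /OCS_dist take0/=.
  by rewrite (sum_mulr_pred1 (fun M => (unmatched S M)%:R)) lern1 leq_b1.
pose r := Ordinal jn; rewrite -/(nat_of_ord r) in IH *.
pose T := [set s in S | e s r]%SET.
set Q := \prod_(s in S) (f (past r s))^-1 in IH *.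
have inT s : (s \in T) = (s \in S) && e s r by rewrite inE.
have QS : \prod_(s in S) (f (past r.+1 s))^-1 =
    Q * (\prod_(s in T) (f (past r s).+1 / f (past r s)))^-1.
  rewrite -prodfV (eq_bigl _ _ inT) big_mkcondr -big_split/=.
  apply: eq_bigr => s _; rewrite (pastS r); case: (e s r).
    by rewrite addn1 invf_div mulrA mulVf ?mul1r// gt_eqF.
  by rewrite addn0 mulr1.
have Q_gt0 : 0 < Q by apply: prodr_gt0 => s _; rewrite invr_gt0.
have jn' : (j <= n)%N := ltnW jn.
have [T0|T0] := eqVneq T finset.set0.
  rewrite QS T0 big_set0 invr1 mulr1.
  exact: le_trans (prob_unmatchedS_le_id r S) (IH S jn').
set y := \sum_(s in T) f (past r s).
have y_gt0 : 0 < y by apply: sum_f_gt0.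
have yE : y = \sum_(s in S | e s r) f (past r s) by apply: eq_bigl.
have TN : (#|T| + #|[set s | (s \notin S) && e s r]%SET| <= d)%N.
  apply: leq_trans (degree_le r).
  rewrite -(cardsID S [set s | e s r]%SET) leq_add// subset_leq_card//;
    by apply/fintype.subsetP => s; rewrite !inE => /andP[-> ->].
have Td : (#|T| <= d)%N by apply: leq_trans TN; apply: leq_addr.
(* At most [x0] neighbors lie outside [S], and by induction each contributes at most [Q] to the
   linear term. With the tangent taken at [x0] the bound collapses to [Q * (x0 / (x0 + y))]. *)
pose x0 : R := d%:R - #|T|%:R.
have x0_ge0 : 0 <= x0 by rewrite subr_ge0 ler_nat.
have x0y : 0 < x0 + y by rewrite ltr_wpDl.
have bound : prob_unmatched r.+1 S <= Q * (x0 / (x0 + y)).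
  have := @prob_unmatchedS_le r S _ x0_ge0; rewrite -yE => /(_ y_gt0).
  move=> /le_trans; apply.
  have -> : Q * (x0 / (x0 + y)) =
     (x0 / (x0 + y)) ^+ 2 * Q + y / (x0 + y) ^+ 2 * (Q * x0).
    by field; rewrite gt_eqF.
  rewrite lerD// ler_wpM2l ?sqr_ge0 ?IH//; first by rewrite divr_ge0 ?sqr_ge0 ?ltW.
  apply: (@le_trans _ _ (\sum_(s | (s \notin S) && e s r) Q)).
    apply: ler_sum => s /andP[sS _].
    apply: le_trans (ler_wpM2l (ltW (f_gt0 _)) (IH _ jn')) _.
    by rewrite big_setU1//= mulrA mulfV ?mul1r// gt_eqF.
  rewrite (eq_bigl [in [set s | (s \notin S) && e s r]%SET]); last first.
    by move=> s; rewrite inE.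
  by rewrite sumr_const -mulr_natr ler_wpM2l ?(ltW Q_gt0)// lerBrDl -natrD ler_nat.
apply: le_trans bound _; rewrite QS ler_pM2l//.
(* If [#|T| = d], [f_growth] does not apply, but the bound is then zero. *)
have [x00|x0_neq0] := eqVneq x0 0.
  rewrite x00 mul0r invr_ge0 prodr_ge0// => s _.
  by rewrite divr_ge0// ltW.
have x0_gt0 : 0 < x0 by rewrite lt_neqAle eq_sym x0_neq0.
rewrite -[leLHS]invrK lef_pV2 ?posrE; last 2 first.
- by rewrite invr_gt0 divr_gt0.
- by apply: prodr_gt0 => s _; rewrite divr_gt0.
have -> : (x0 / (x0 + y))^-1 = 1 + y / x0 by field; rewrite !gt_eqF.
apply: prod_growth_le; rewrite card_gt0 T0/=.
by move: x0_gt0; rewrite subr_gt0 ltr_nat.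
Qed.

(** * Expected matching size and competitive ratio *)

Lemma E_OCS_ge (c : R) : 0 < c ->
  (forall s, c <= f #|[set r : 'I_n | e s r]%SET|) ->
  m%:R * (1 - c^-1) <= E_OCS f e.
Proof.
move=> c_gt0 hc; rewrite /E_OCS OCS_law_dist.
have h (s : 'I_m) : 1 - c^-1 <= 1 - prob_unmatched n [set s]%SET.
  rewrite lerB// (le_trans (@prob_unmatched_le n _ (leqnn n)))// big_set1 past_n.
  by rewrite lef_pV2 ?posrE.
apply: (@le_trans _ _ (\sum_(s : 'I_m) (1 - prob_unmatched n [set s]%SET))).
  rewrite mulrC mulr_natr -[m in leLHS]card_ord -sumr_const.
  exact: ler_sum.
under eq_bigr do rewrite -(@sum_OCS_dist n (leqnn n)) -sumrB.
rewrite exchange_big/=; apply: ler_sum => M _.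
under eq_bigr do rewrite -{1}[OCS_dist n M]mulr1 -mulrBr.
rewrite -mulr_sumr ler_wpM2l ?OCS_dist_ge0//.
(* The size of [M] is at least the number of servers it covers. *)
apply: (@le_trans _ _ #|[set p.1 | p in M]%SET|%:R); last first.
  by rewrite ler_nat leq_imset_card.
rewrite -sum1_card natr_sum [leRHS]big_mkcond/=; apply: ler_sum => s _.
case: (boolP (unmatched _ M)) => hu; first by rewrite subrr; case: ifP.
rewrite subr0 ifT//; move: hu; rewrite negb_forall => /existsP[s'].
rewrite negb_imply inE negb_forall => /andP[/eqP -> /existsP[r]].
by rewrite negbK => sr; apply/imsetP; exists (s, r).
Qed.

End OCSAnalysis.

Lemma OPT_le (m n : nat) (e : 'I_m -> 'I_n -> bool) : (OPT e <= m)%N.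
Proof.
apply/bigmax_leqP => M /andP[_ /forall_inP h].
rewrite -[leqRHS]card_ord -(@card_in_imset _ _ fst) ?max_card// => p q pM qM pq.
by have /forall_inP/(_ q qM) := h p pM; rewrite pq eqxx/= => /eqP.
Qed.

(** [1 <= c] makes [1 - c^-1] nonnegative, so that [OPT e] can replace the number of servers, which
    is at least as large. *)
Lemma OCS_competitive_ratio_ge (R : realType) (f : nat -> R) (k d : nat) (c : R) :
  (forall l, 0 < f l) -> f 0%N = 1 ->
  (forall l j, (0 < j < d)%N ->
     (f l.+1 / f l) ^+ j <= 1 + j%:R * f l / (d%:R - j%:R)) ->
  1 <= c -> (forall l, (k <= l)%N -> c <= f l) ->
  ((1 - c^-1)%:E <= OCS_competitive_ratio f k d)%E.
Proof.
move=> f_gt0 f0 f_growth c1 hc; apply: le_ereal_inf_tmp => _ [m [n [e [[ek ed] O0 ->]]]].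
rewrite lee_fin ler_pdivlMr ?ltr0n//.
have c_gt0 : 0 < c by lra.
apply: le_trans (@E_OCS_ge _ f d m n e f_gt0 f0 f_growth ed c c_gt0 _); last first.
  by move=> s; apply: hc.
rewrite mulrC ler_wpM2r ?ler_nat ?OPT_le// subr_ge0.
by rewrite invf_le1.
Qed.

(** * Growth rate of the weight function *)

Section GrowthRate.
Context {R : realType}.
Implicit Types y c t s u v w : R.

(* [c <= h(y)] *)
Definition growth_rate y c : Prop :=
  forall v, 0 < v -> c * v <= ln (1 + v) * (v + y).

Lemma growth_rate_mono y c y' c' :
  growth_rate y c -> y <= y' -> c' <= c -> growth_rate y' c'.
Proof.
move=> h yy' cc' v v_gt0; have := h v v_gt0.
have ln0 : 0 <= ln (1 + v) by rewrite ln_ge0// lerDl ltW.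
have := ler_wpM2l ln0 yy'; have := ler_wpM2r (ltW v_gt0) cc'.
by lra.
Qed.

(** For fixed [v] the inequality is affine in [(y, c)]; this is the concavity of [h]. *)
Lemma growth_rate_convex t y1 c1 y2 c2 : 0 <= t <= 1 ->
  growth_rate y1 c1 -> growth_rate y2 c2 ->
  growth_rate ((1 - t) * y1 + t * y2) ((1 - t) * c1 + t * c2).
Proof.
move=> /andP[t0 t1] h1 h2 v v_gt0.
have /(ler_wpM2l (_ : 0 <= 1 - t)) := h1 v v_gt0; rewrite subr_ge0 => /(_ t1).
have /(ler_wpM2l t0) := h2 v v_gt0.
by lra.
Qed.

Lemma growth_rate_ge0 y : 0 <= y -> growth_rate y 0.
Proof.
move=> y0 v v_gt0; rewrite mul0r mulr_ge0 ?addr_ge0 ?(ltW v_gt0)//.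
by rewrite ln_ge0// lerDl ltW.
Qed.

(* With [v = expR t - 1], [growth_rate y c] reads [0 <= psi y c t]. *)
Definition psi y c t : R := expR t * (t - c) + (y - 1) * t + c.
Definition dpsi y c t : R := expR t * (t - c + 1) + (y - 1).

Lemma growth_rate_psi y c : (forall t, 0 <= t -> 0 <= psi y c t) -> growth_rate y c.
Proof.
move=> h v v_gt0; have v1 : 0 < 1 + v by lra.
have ln0 : 0 <= ln (1 + v) by rewrite ln_ge0// lerDl ltW.
have := h _ ln0.
by rewrite /psi lnK ?posrE//; lra.
Qed.

Lemma is_derive_psi y c t : is_derive t 1 (psi y c) (dpsi y c t).
Proof.
rewrite /psi /dpsi; apply: is_derive_eq.
by rewrite /GRing.scale/= /dpsi; ring.
Qed.

Lemma psi_MVT y c u w : u < w -> exists2 t, u < t < w &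
  psi y c w - psi y c u = dpsi y c t * (w - u).
Proof.
move=> uw.
have [|t tuw h] := MVT uw (fun t _ => is_derive_psi y c t).
  apply: derivable_within_continuous => t _.
  exact: (@ex_derive _ _ _ _ _ _ _ (is_derive_psi y c t)).
by exists t.
Qed.

(** The derivative of [dpsi y c] is [expR t * (t - c + 2)], which changes sign at [c - 2]; in place
    of a second derivative the proof uses [1 + x <= expR x]. *)
Lemma dpsi_incr y c u w : c - 2 <= u -> u <= w -> dpsi y c u <= dpsi y c w.
Proof.
move=> cu uw; rewrite /dpsi lerD2r.
have [h|h] := leP 0 (u - c + 1).
  by rewrite ler_pM ?expR_ge0 ?ler_expR//; lra.
have -> : u = w - (w - u) by ring.
rewrite expRD -mulrA ler_wpM2l ?expR_ge0//.
have /(ler_wnM2r (ltW h)) := expR_ge1Dx (- (w - u)).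
have : 0 <= (w - u) * (u - (c - 2)) by rewrite mulr_ge0 ?subr_ge0.
by lra.
Qed.

Lemma dpsi_decr y c u w : u <= w -> w <= c - 2 -> dpsi y c w <= dpsi y c u.
Proof.
move=> uw wc; rewrite /dpsi lerD2r.
have -> : w = u + (w - u) by ring.
rewrite expRD -mulrA ler_wpM2l ?expR_ge0//.
have w1 : w - c + 1 <= 0 by lra.
have /(ler_wnM2r w1) := expR_ge1Dx (w - u).
have : 0 <= (w - u) * (c - 2 - w) by rewrite mulr_ge0 ?subr_ge0.
by lra.
Qed.

Lemma psi0 y c : psi y c 0 = 0.
Proof. by rewrite /psi expR0; ring. Qed.

(* [psi y c] is concave before [c - 2] and convex after it; on the concave part
   it is bounded below by its values at the end points. *)
Lemma psi_ge0 y c s : c - 2 <= s -> 0 <= psi y c s -> dpsi y c s = 0 ->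
  forall t, 0 <= t -> 0 <= psi y c t.
Proof.
move=> cs psis dpsis.
have convex_part t : c - 2 <= t -> 0 <= psi y c t.
  move=> ct; apply: le_trans psis _; rewrite -subr_ge0.
  have [ts|st|->] := ltgtP t s; last by rewrite subrr.
    have [x /andP[tx xs] h] := psi_MVT y c ts.
    rewrite -opprB h oppr_ge0; apply: mulr_le0_ge0; last by rewrite subr_ge0 ltW.
    by rewrite -dpsis; apply: dpsi_incr; lra.
  have [x /andP[sx xt] ->] := psi_MVT y c st.
  apply: mulr_ge0; last by rewrite subr_ge0 ltW.
  by rewrite -dpsis; apply: dpsi_incr; lra.
move=> t t_ge0; have [|tc] := leP (c - 2) t; first exact: convex_part.
rewrite leNgt; apply/negP => psit.
have t_gt0 : 0 < t.
  by rewrite lt_neqAle t_ge0 andbT; apply: contraTneq psit => <-; rewrite psi0 ltxx.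
have [x /andP[x0 xt] hx] := psi_MVT y c t_gt0.
have [z /andP[tz zc] hz] := psi_MVT y c tc.
have xz : dpsi y c z <= dpsi y c x by apply: dpsi_decr; lra.
have psic := convex_part (c - 2) (lexx _).
have dx : dpsi y c x < 0.
  by rewrite -(pmulr_llt0 _ t_gt0) -[t]subr0 -hx psi0 subr0.
have : 0 < dpsi y c z * (c - 2 - t) by rewrite -hz; lra.
by rewrite pmulr_lgt0; lra.
Qed.

(** For [y = c = 2] the critical point 0 is also the inflection point [c - 2], and [psi] vanishes
    there. *)
Lemma psi22_ge0 t : 0 <= t -> 0 <= psi 2 2 t.
Proof.
by apply: (@psi_ge0 _ _ 0); rewrite ?psi0 ?/dpsi ?expR0 ?subrr//; ring.
Qed.

Lemma growth_rate_22 : growth_rate 2 2.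
Proof. exact/growth_rate_psi/psi22_ge0. Qed.

(** Interpolation between the points (0, 0) and (2, 2). *)
Lemma growth_rate_le2 y : 0 <= y <= 2 -> growth_rate y y.
Proof.
move=> /andP[y0 y2].
have := @growth_rate_convex (y / 2) 0 0 2 2 _ (growth_rate_ge0 (lexx 0)) growth_rate_22.
by rewrite !mulr0 !add0r divfK//; apply; lra.
Qed.

(* This is the value of [h] whose infimum is attained at [1 + v = expR 2]. *)
Lemma growth_rate_exp2 (K := expR 2 : R) :
  growth_rate ((K - 1) ^+ 2 / (K + 1)) (4 * K / (K + 1)).
Proof.
have K0 : 0 < K + 1 by rewrite addr_gt0 ?expR_gt0.
apply/growth_rate_psi/(@psi_ge0 _ _ 2).
- by rewrite lerBlDr ler_pdivrMr//; lra.
- rewrite le_eqVlt; apply/orP; left; apply/eqP.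
  by rewrite /psi -/K; field; rewrite gt_eqF.
- by rewrite /dpsi -/K; field; rewrite gt_eqF.
Qed.

(** * Numerical bounds on the exponential *)

(** A rearrangement of [0 <= psi 2 2 t]; for [t < 2] it bounds [expR t] above by
    [(2 + t) / (2 - t)]. *)
Lemma expR_mul_le t : 0 <= t -> expR t * (2 - t) <= 2 + t.
Proof. by move=> /psi22_ge0; rewrite /psi; lra. Qed.

Lemma expR_ge2 t : 0 <= t -> 1 + t + t ^+ 2 / 2 <= expR t.
Proof.
rewrite le_eqVlt => /predU1P[<-|t0]; first by rewrite expR0; lra.
pose g (x : R) := expR x - (1 + x + x * x / 2).
have dg (x : R) : is_derive x 1 g (expR x - (1 + x)).
  rewrite /g; apply: is_derive_eq; rewrite /GRing.scale/=. by field.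
have [|x _] := MVT t0 (fun x _ => dg x).
  by apply: derivable_within_continuous => x _; apply: (@ex_derive _ _ _ _ _ _ _ (dg x)).
rewrite /g expR0 => h; rewrite -subr_ge0.
have : 0 <= (expR x - (1 + x)) * (t - 0).
  by rewrite mulr_ge0 ?subr_ge0 ?expR_ge1Dx// ltW.
by rewrite -h; lra.
Qed.

Lemma expR2_le : expR 2 <= 37 / 5 :> R.
Proof.
have h : expR (1 / 16) <= 33 / 31 :> R.
  have := @expR_mul_le (1 / 16); lra.
have -> : 2 = 32%:R * (1 / 16) :> R by field.
rewrite expRM_natl.
apply: (@le_trans _ _ ((33 / 31) ^+ 32)); last by lra.
by apply: lerXn2r h; rewrite nnegrE; [exact: expR_ge0|lra].
Qed.

Lemma expR2_ge : 1469 / 200 <= expR 2 :> R.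
Proof.
have h : 145 / 128 <= expR (1 / 8) :> R.
  by apply: (le_trans _ (expR_ge2 _)); lra.
have -> : 2 = 16%:R * (1 / 8) :> R by field.
rewrite expRM_natl.
apply: (@le_trans _ _ ((145 / 128) ^+ 16)); first by lra.
by apply: lerXn2r h; rewrite nnegrE; [lra|exact: expR_ge0].
Qed.

(** The decay of [a / y + b] in the chord phase: rate 118/125 for time 87/250. *)
Lemma expRN_le : expR (- (118 / 125 * (87 / 250))) <= 721 / 1000 :> R.
Proof.
have h : 299 / 287 <= expR (118 / 125 * (87 / 250) / 8) :> R.
  by apply: (le_trans _ (expR_ge2 _)); lra.
have h8 : (299 / 287) ^+ 8 <= expR (118 / 125 * (87 / 250)) :> R.
  have -> : 118 / 125 * (87 / 250) =
    8%:R * (118 / 125 * (87 / 250) / 8) :> R by field.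
  by rewrite expRM_natl; apply: lerXn2r h; rewrite nnegrE; [lra|exact: expR_ge0].
by rewrite expRN -[leLHS]mul1r ler_pdivrMr ?expR_gt0; lra.
Qed.

(** From 122/25 at time 17/20, growth at rate 88/25 over the remaining 3/20 reaches [3 e] at time
    1. *)
Lemma expR_tail_ge : 3 * expR 1 <= 122 / 25 * expR (88 / 25 * (3 / 20)) :> R.
Proof.
have -> : expR 1 = expR (88 / 25 * (3 / 20)) * expR (59 / 125) :> R.
  by rewrite -expRD; congr expR; field.
have hB : expR (59 / 125) <= 809 / 500 :> R.
  by have := @expR_mul_le (59 / 125); lra.
set A := expR (88 / 25 * (3 / 20)).
have A0 : 0 <= A by apply: expR_ge0.
by have := ler_wpM2l A0 hB; lra.
Qed.

(* The exact point is [Y = 4.866.., h(Y) = 3.523..]; the rounded one is placed on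
   the line [0.944 + 0.528 y] through [(2, 2)]. *)
Lemma growth_rate_chord_end :
  growth_rate (122 / 25) (118 / 125 + 66 / 125 * (122 / 25) : R).
Proof.
have K1 := expR2_le; have K2 := expR2_ge.
apply: growth_rate_mono growth_rate_exp2 _ _; set K := expR 2 in K1 K2 *.
  have : 0 <= (37 / 5 - K) * (K - 1469 / 200) by rewrite mulr_ge0 ?subr_ge0.
  by rewrite ler_pdivrMr; lra.
by rewrite ler_pdivlMr; lra.
Qed.

Lemma growth_rate_chord y : 2 <= y <= 122 / 25 ->
  growth_rate y (118 / 125 + 66 / 125 * y).
Proof.
move=> /andP[y1 y2].
have := @growth_rate_convex ((y - 2) / (72 / 25)) _ _ _ _ _
  growth_rate_22 growth_rate_chord_end.
have -> : (1 - (y - 2) / (72 / 25)) * 2 + (y - 2) / (72 / 25) * (122 / 25) = y.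
  by field.
move=> h; apply: growth_rate_mono (h _) _ _ => //; lra.
Qed.

Lemma growth_rate_tail y : 122 / 25 <= y -> growth_rate y (88 / 25).
Proof.
by move=> hy; apply: (growth_rate_mono growth_rate_chord_end hy); lra.
Qed.

End GrowthRate.

(** * Growth of [fstar] in time steps of length [1 / d] *)

Section Fstar.
Context {R : realType} (d : nat).
Hypothesis d_ge2 : (2 <= d)%N.
Local Notation f := (fstar R d).

Let base (y : R) (j : nat) : R := 1 + j%:R * y / (d%:R - j%:R).
Let term (y : R) (j : nat) : R := base y j `^ (j%:R^-1).

Lemma fstarS l : f l.+1 = f l * \big[Num.min/term (f l) 1%N]_(1 <= j < d) term (f l) j.
Proof. by []. Qed.

Lemma base_gt1 y j : 0 < y -> (0 < j < d)%N -> 1 < base y j.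
Proof.
move=> y0 /andP[j0 jd]; rewrite ltrDl divr_gt0 ?mulr_gt0 ?ltr0n//.
by rewrite subr_gt0 ltr_nat.
Qed.

Lemma term_gt0 y j : 0 < y -> (0 < j < d)%N -> 0 < term y j.
Proof. by move=> y0 jd; rewrite powR_gt0// (lt_trans ltr01)// base_gt1. Qed.

(** With [v = j y / (d - j)] one has [v + y = d v / j], so the rate inequality at [v] becomes
    [c / d <= ln (1 + v) / j], whose right side is the logarithm of the term. *)
Lemma growth_rate_term (y c : R) j : 0 < y -> growth_rate y c -> (0 < j < d)%N ->
  expR (c / d%:R) <= term y j.
Proof.
move=> y0 h jd; have b1 := base_gt1 y0 jd; have t0 := term_gt0 y0 jd.
have /andP[j0 jltd] := jd.
have jR : 0 < j%:R :> R by rewrite ltr0n.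
have dj : 0 < d%:R - j%:R :> R by rewrite subr_gt0 ltr_nat.
have dR : 0 < d%:R :> R by rewrite ltr0n (ltn_trans j0).
rewrite -ler_ln ?posrE ?expR_gt0// expRK ln_powR.
rewrite ler_pdivrMr// -mulrA ler_pdivlMl// mulrC.
have v0 : 0 < j%:R * y / (d%:R - j%:R) by rewrite divr_gt0 ?mulr_gt0.
have := h _ v0; rewrite -/(base y j).
have -> : j%:R * y / (d%:R - j%:R) + y = d%:R * (y / (d%:R - j%:R)).
  by field; rewrite gt_eqF.
by rewrite -(mulrA j%:R) !(mulrA _ _ (y / _)) ler_pM2r ?divr_gt0.
Qed.

(** The default value is the term at 1, which is in range since [2 <= d]. *)
Lemma bigmin_term_ge y c : (forall j, (0 < j < d)%N -> c <= term y j) ->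
  c <= \big[Num.min/term y 1%N]_(1 <= j < d) term y j.
Proof.
move=> h; rewrite big_seq_cond; apply: le_bigmin; first by apply: h.
by move=> j; rewrite andbT mem_index_iota => /h.
Qed.

Lemma fstar_gt0 l : 0 < f l.
Proof.
elim: l => [|l IH]; first exact: ltr01.
rewrite fstarS mulr_gt0//; apply: lt_le_trans (bigmin_term_ge _).
  exact: (expR_gt0 (0 / d%:R)).
by move=> j; apply: growth_rate_term => //; apply: growth_rate_ge0; apply: ltW.
Qed.

Lemma fstarS_ge l c : growth_rate (f l) c -> f l * expR (c / d%:R) <= f l.+1.
Proof.
move=> h; rewrite fstarS ler_pM2l ?fstar_gt0//; apply: bigmin_term_ge => j.
exact: growth_rate_term (fstar_gt0 _) h.
Qed.

(** This rational form makes the effect of a step on reciprocals exactly computable. *)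
Lemma fstarS_ge1D l c : growth_rate (f l) c -> f l * (1 + c / d%:R) <= f l.+1.
Proof.
move=> /fstarS_ge; apply: le_trans; rewrite ler_pM2l ?fstar_gt0//.
exact: expR_ge1Dx.
Qed.

Lemma fstar_homo : {homo f : l l' / (l <= l')%N >-> l <= l'}.
Proof.
apply: homo_leq => // [x y z|l]; first exact: le_trans.
have := fstarS_ge (growth_rate_ge0 (ltW (fstar_gt0 l))).
by rewrite mul0r expR0 mulr1.
Qed.

Lemma fstar_growth l j : (0 < j < d)%N ->
  (f l.+1 / f l) ^+ j <= 1 + j%:R * f l / (d%:R - j%:R).
Proof.
move=> jd; have f0 := fstar_gt0 l; have b0 := base_gt1 f0 jd.
have j0 : j != 0%N by case/andP: jd; rewrite lt0n.
rewrite fstarS mulrC mulKf ?gt_eqF//.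
have -> : 1 + j%:R * f l / (d%:R - j%:R) = term (f l) j ^+ j.
  rewrite -powR_mulrn ?powR_ge0// -powRrM mulVf ?pnatr_eq0// powRr1//.
  by rewrite ltW// (lt_trans ltr01).
rewrite ler_pXn2r ?nnegrE ?lt0n//; first by apply: bigmin_inf_seq (lexx _);
  rewrite ?mem_index_iota.
- by apply: bigmin_term_ge => i h; rewrite ltW// term_gt0.
- by rewrite ltW// term_gt0.
Qed.


(** While [f l < 2], the rate is [f l] and each step lowers [1 / f] by at least [1 / (d + 2)], as in
    [y' = y ^ 2]. *)
Lemma fstar_ge2 l : d%:R + 2 <= 2 * l%:R :> R -> 2 <= f l.
Proof.
have d0 : 0 < d%:R :> R by rewrite ltr0n (leq_trans _ d_ge2).
move=> hl.
have : 2 <= f l \/ (f l)^-1 <= 1 - l%:R / (d%:R + 2).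
  elim: l {hl} => [|l IH]; first by right; rewrite invr1 mul0r subr0.
  have [f2|f2] := leP 2 (f l).
    by left; apply: le_trans f2 (fstar_homo (leqnSn l)).
  right; case: IH => [|IH]; first by rewrite leNgt f2.
  have f0 := fstar_gt0 l.
  have := fstarS_ge1D (@growth_rate_le2 _ (f l) _).
  rewrite (ltW f0) (ltW f2) => /(_ isT) h.
  have g0 : 0 < f l * (1 + f l / d%:R) by rewrite mulr_gt0 ?addr_gt0 ?divr_gt0.
  have : (f l.+1)^-1 <= (f l * (1 + f l / d%:R))^-1.
    by rewrite lef_pV2 ?posrE ?fstar_gt0.
  have -> : (f l * (1 + f l / d%:R))^-1 = (f l)^-1 - (d%:R + f l)^-1.
    by field; rewrite !gt_eqF ?addr_gt0.
  have : (d%:R + 2)^-1 <= (d%:R + f l)^-1.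
    by rewrite lef_pV2 ?posrE ?addr_gt0// lerD2l ltW.
  by move=> h1 h2; rewrite -natr1 mulrDl mul1r; lra.
case=> // h; have : (f l)^-1 <= 2^-1.
  apply: le_trans h _; rewrite lerBlDl -lerBlDr ler_pdivlMr ?addr_gt0//.
  by lra.
by rewrite lef_pV2 ?posrE ?fstar_gt0.
Qed.

Let a : R := 118 / 125.
Let b : R := 66 / 125.

(* Along [y' = y (a + b y)] the quantity [a / y + b] decays exponentially, with
   rate [a]. *)
Lemma fstar_chord l n : 2 <= f l ->
  122 / 25 <= f (l + n) \/ a / f (l + n) + b <= (1 - a / (d%:R + 5)) ^+ n.
Proof.
have d0 : 0 < d%:R :> R by rewrite ltr0n (leq_trans _ d_ge2).
have a0 : 0 < a by rewrite /a; lra.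
move=> f2; elim: n => [|n IH].
  right; rewrite addn0 expr0.
  have : a / f l <= a / 2 by rewrite ler_pM2l// lef_pV2 ?posrE ?fstar_gt0.
  by rewrite /a /b; lra.
rewrite addnS; set y := f (l + n) in IH *.
have [y5|y5] := leP (122 / 25) y.
  by left; apply: le_trans y5 (fstar_homo (leqnSn _)).
right; case: IH => [|IH]; first by rewrite leNgt y5.
have y2 : 2 <= y by apply: le_trans f2 (fstar_homo (leq_addr _ _)).
have y0 : 0 < y by lra.
pose h := a + b * y.
have h0 : 0 < h by rewrite /h /a /b; lra.
(* A crude bound on [h], which makes the contraction factor the same at every step. *)
have h5 : h <= 5 by rewrite /h /a /b; lra.
have : y * (1 + h / d%:R) <= f (l + n).+1.
  by apply: fstarS_ge1D; apply: growth_rate_chord; rewrite y2 ltW.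
have g0 : 0 < y * (1 + h / d%:R) by rewrite mulr_gt0 ?addr_gt0 ?divr_gt0.
rewrite -lef_pV2 ?posrE ?fstar_gt0// => /(ler_wpM2l (ltW a0)) hS.
(* Since [a / y + b = h / y], the discrete step contracts this quantity by an exact factor. *)
have step : a * (y * (1 + h / d%:R))^-1 + b = (a / y + b) * (1 - a / (d%:R + h)).
  by rewrite /h; field; rewrite !gt_eqF// addr_gt0.
apply: (@le_trans _ _ ((a / y + b) * (1 - a / (d%:R + h)))).
  by rewrite -step lerD2r.
have w0 : 0 <= a / y + b by rewrite addr_ge0 ?divr_ge0 ?ltW// /b; lra.
have dh : 0 < d%:R + h by apply: addr_gt0.
have d5 : 0 < d%:R + 5 :> R by lra.
rewrite exprSr; apply: ler_pM => //.
  by rewrite subr_ge0 ler_pdivrMr// /h /a /b; lra.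
by apply: lerB => //; rewrite ler_pM2l// lef_pV2 ?posrE// lerD2l.
Qed.

Lemma fstar_ge488 l n : 2 <= f l -> 87 / 250 * (d%:R + 5) <= n%:R :> R ->
  122 / 25 <= f (l + n).
Proof.
move=> f2 hn; case: (fstar_chord n f2) => // h.
have d0 : 0 < d%:R :> R by rewrite ltr0n (leq_trans _ d_ge2).
have d5 : 0 < d%:R + 5 :> R by lra.
have a0 : 0 < a by rewrite /a; lra.
have y0 := fstar_gt0 (l + n).
have : (1 - a / (d%:R + 5)) ^+ n <= 721 / 1000.
  apply: le_trans expRN_le.
  apply: (@le_trans _ _ (expR (- (a / (d%:R + 5))) ^+ n)).
    apply: lerXn2r (expR_ge1Dx _); rewrite nnegrE; last exact: expR_ge0.
    by rewrite subr_ge0 ler_pdivrMr// /a; lra.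
  have : a * (87 / 250) <= n%:R * (a / (d%:R + 5)).
    by rewrite [leRHS]mulrCA ler_pM2l// ler_pdivlMr.
  by rewrite -expRM_natl ler_expR mulrN lerN2.
(* Here 721/1000 is just below [a / y + b] at [y = 122 / 25]. *)
move=> /(le_trans h); rewrite -lerBrDr ler_pdivrMr// /a /b; lra.
Qed.

Lemma fstar_tail l n : 122 / 25 <= f l ->
  122 / 25 * expR (88 / 25 * (n%:R / d%:R)) <= f (l + n).
Proof.
move=> fl; elim: n => [|n IH]; first by rewrite mul0r mulr0 expR0 mulr1 addn0.
rewrite addnS.
have h : growth_rate (f (l + n)) (88 / 25).
  by apply: growth_rate_tail; apply: le_trans fl (fstar_homo (leq_addr _ _)).
apply: le_trans (fstarS_ge h).
have -> : 88 / 25 * (n.+1%:R / d%:R) =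
    88 / 25 * (n%:R / d%:R) + 88 / 25 / d%:R :> R.
  by rewrite -natr1; ring.
by rewrite expRD [leLHS]mulrA; apply: ler_wpM2r IH; apply: expR_ge0.
Qed.

Lemma fstar_ge_powR (alpha : R) k : (3000 <= d)%N -> 1 < alpha ->
  k%:R = alpha * d%:R -> (3 * expR 1) `^ alpha <= f k.
Proof.
move=> d3000 alpha1 kE.
have dR : 3000 <= d%:R :> R by rewrite (ler_nat _ 3000).
have d0 : 0 < d%:R :> R by lra.
pose l1 := (d./2 + 2)%N.
have half : d%:R = (odd d)%:R + 2 * (d./2)%:R :> R.
  by rewrite -natrM -natrD mul2n odd_double_half.
have odd0 : 0 <= (odd d)%:R :> R by exact: ler0n.
have odd1 : (odd d)%:R <= 1 :> R by rewrite lern1 leq_b1.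
have f1 : 2 <= f l1 by apply: fstar_ge2; rewrite /l1 natrD; lra.
pose x : R := 87 / 250 * (d%:R + 5).
have x0 : 0 <= x by rewrite /x; lra.
have /andP[n1 n2] := truncn_itv x0.
have f2 : 122 / 25 <= f (l1 + (Num.truncn x).+1).
  by apply: fstar_ge488 f1 (ltW _).
set l2 := (l1 + _)%N in f2.
(* Rounding included, [l2] is at most [0.848 d + 4.74]; the threshold 3000 for [d] absorbs the
   constant. *)
have l2d : l2%:R <= 17 / 20 * d%:R :> R.
  by rewrite /l2 /l1 !natrD -natr1; move: n1; rewrite /x; lra.
have l2k : (l2 <= k)%N.
  by rewrite -(ler_nat R) kE; have := ler_peMl (ltW d0) (ltW alpha1); lra.
rewrite -(subnKC l2k); apply: le_trans (fstar_tail _ f2).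
apply: (@le_trans _ _ (122 / 25 * expR (88 / 25 * (alpha - 17 / 20)))); last first.
  rewrite ler_pM2l; last by lra.
  rewrite ler_expR ler_pM2l; last by lra.
  by rewrite ler_pdivlMr// natrB// kE; lra.
(* The exponent is split at time 1: the first part yields [3 e], the second its power
   [alpha - 1]. *)
have -> : 88 / 25 * (alpha - 17 / 20) =
    88 / 25 * (3 / 20) + 88 / 25 * (alpha - 1) :> R by field.
rewrite expRD [leRHS]mulrA.
have e0 : 0 < 3 * expR 1 :> R by rewrite mulr_gt0 ?expR_gt0.
have -> : (3 * expR 1) `^ alpha = 3 * expR 1 * (3 * expR 1) `^ (alpha - 1).
  by rewrite mulr_powRB1 ?ltW//; lra.
apply: ler_pM; [exact: ltW|exact: powR_ge0|exact: expR_tail_ge|].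
(* It suffices that [ln (3 e) <= 88 / 25], which follows from [ln 3 <= 2]. *)
rewrite /powR gt_eqF// ler_expR mulrC ler_wpM2r//; first by lra.
rewrite lnM ?posrE ?expR_gt0// expRK.
have := @le_ln1Dx R 2; have -> : 1 + 2 = 3 :> R by ring.
by lra.
Qed.

End Fstar.

(** * The limit inferior over [d] *)

Unset Implicit Arguments.

Theorem theoremE4 (R : realType) (alpha : R) (halpha : 1 < alpha) :
  ((1 - (1 / (3 * expR 1)) `^ alpha)%R%:E <=
   limf_einf
     (fun d : nat =>
        OCS_competitive_ratio (fstar R d) (Num.truncn (alpha * d%:R)%R) d)
     (within [set d : nat | (2 <= d)%N /\ (alpha * d%:R)%R \is a Num.nat]
        \oo))%E.
Proof.
have e1 : 1 <= 3 * expR 1 :> R by have := expR_ge1Dx (1 : R); lra.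
have -> : (1 / (3 * expR 1)) `^ alpha = ((3 * expR 1) `^ alpha)^-1.
  by rewrite div1r -powR_inv1 -?powRrM ?mulN1r ?powRN//; lra.
rewrite limf_einfE.
(* The limit inferior is a supremum of infima over the sets of the filter, so a uniform bound on
   this one is enough. On [V] the truncation of [alpha * d] is exact. *)
pose V := [set d : nat | (3000 <= d)%N /\ (alpha * d%:R) \is a Num.nat].
apply: (@le_trans _ _ (ereal_inf ((fun d : nat =>
  OCS_competitive_ratio (fstar R d) (Num.truncn (alpha * d%:R)) d) @` V))).
  apply: le_ereal_inf_tmp => _ [d [d3000 ad] <-].
  have d2 : (2 <= d)%N by apply: leq_trans d3000.
  apply: OCS_competitive_ratio_ge => //.
  - exact: fstar_gt0.
  - by move=> l j; apply: fstar_growth.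
  - by have := ler_powR e1 (ltW (lt_trans ltr01 halpha)); rewrite powRr0.
  - move=> l kl; apply: le_trans (fstar_homo d2 kl).
    by apply: fstar_ge_powR => //; rewrite truncnK.
apply: ereal_sup_ubound; exists V => //.
by exists 3000%N => // d /= hd [].
Qed.
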